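(* For every integer $d\geq 2$ and every integer $N$, there exists a $(d+1)$-dimensional simplicial polytope $\mathbf{P}$ with at least $N$ vertices such that $\tau(\mathcal{F}(\mathbf{P}))/n=\frac{2}{d+2}$ exactly, where $n$ is the number of vertices of $\mathbf{P}$. (That is, there are infinitely many $(d+1)$-dimensional simplicial polytopes with transversal ratio exactly $\frac{2}{d+2}$.)
   Context: For a polytope $\mathbf{P}$, the facet hypergraph $\mathcal{F}(\mathbf{P})$ is the hypergraph on the vertex set of $\mathbf{P}$ whose hyperedges are the vertex sets of the facets of $\mathbf{P}$. For a hypergraph $\mathcal{H}$, a transversal is a set $T\subseteq V(\mathcal{H})$ meeting every hyperedge, and $\tau(\mathcal{H})$ is the minimum size of a transversal. The transversal ratio of $\mathbf{P}$ is $\tau(\mathcal{F}(\mathbf{P}))/n$ where $n$ is its number of vertices. *)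

(* Defs.v *)
From HB Require Import structures.
From mathcomp Require Import all_boot all_order all_algebra.
From mathcomp Require Import boolp reals.
Set Implicit Arguments. Unset Strict Implicit. Unset Printing Implicit Defensive.
Import Order.TTheory GRing.Theory Num.Theory.
Local Open Scope ring_scope.

(* A polytope in R^D is given as the convex hull of n points V 0, ..., V (n-1),
   which are required to be in convex position, so that they are exactly the
   vertices of the polytope. *)
Section Polytope.
Variables (R : realFieldType) (D n : nat).
Implicit Types (V : 'I_n -> 'rV[R]_D) (S T : {set 'I_n}).

Definition dotv (a x : 'rV[R]_D) : R := \sum_(k < D) a 0 k * x 0 k.

Definition aff_indep V S : Prop :=
  forall c : 'I_n -> R,
    \sum_(i in S) c i = 0 -> \sum_(i in S) c i *: V i = 0 ->
    forall i, i \in S -> c i = 0.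

Definition convex_position V : Prop :=
  forall (i : 'I_n) (lam : 'I_n -> R),
    (forall j, 0 <= lam j) -> \sum_(j | j != i) lam j = 1 ->
    \sum_(j | j != i) lam j *: V j <> V i.

Definition full_dimensional V : Prop :=
  exists S, aff_indep V S /\ #|S| = D.+1.

Definition face_vertex_set V S : Prop :=
  exists (a : 'rV[R]_D) (b : R), a != 0 /\
    (forall i, dotv a (V i) <= b) /\ S = [set i | dotv a (V i) == b].

(* facet: a face of dimension D-1, i.e. containing D affinely independent
   vertices (a proper face cannot contain D+1 of them). *)
Definition is_facet V S : Prop :=
  face_vertex_set V S /\ exists S', [/\ S' \subset S, aff_indep V S' & #|S'| = D].

Definition simplicial V : Prop := forall S, is_facet V S -> aff_indep V S.

Definition facet_hypergraph V : {set {set 'I_n}} := [set S | `[< is_facet V S >]].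

Definition is_transversal V T : bool :=
  [forall S in facet_hypergraph V, T :&: S != set0].

(* tau(F(P)): minimum size of a transversal (setT, of size n, is always one
   since facets are nonempty, so the default n is harmless) *)
Definition tau V : nat := \big[minn/n]_(T : {set 'I_n} | is_transversal V T) #|T|.

End Polytope.

(* Main.v *)
(** A simplex with [D + 1] vertices has transversal number 2, and there is a way
    to enlarge a simplicial [D]-polytope by [D + 1] vertices that raises the
    transversal number by exactly 2.  Given a facet with vertices [a_j], add
    just beyond its barycentre a small reversed copy [w_j] of the facet, so that the
    new facets are those of the cross-polytope on the pairs [a_j, w_j], and cap
    the facet [w_1, ..., w_D] of the latter with one more vertex [w_0].  A
    transversal meeting the old facet but not containing it needs two new
    vertices; one that misses the old facet needs all the [w_j].  If it contains
    the old facet one new vertex may suffice, so the induction also carries the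
    fact that no minimum transversal contains the distinguished facet, which
    holds again for the facet [w_0, w_2, ..., w_D].

    Polytopes are homogenised: vertices are vectors of [R^(D+1)] with positive
    last coordinate, faces are cut out by linear functionals, and positive
    rescaling of a vertex is harmless. *)

Require Import Defs.
From HB Require Import structures.
From mathcomp Require Import all_boot all_order all_algebra.
From mathcomp Require Import boolp reals.
From mathcomp Require Import zify ring lra.
Import Order.TTheory GRing.Theory Num.Theory.
Local Open Scope ring_scope.
Set Implicit Arguments.
Unset Strict Implicit.
Unset Printing Implicit Defensive.

(** * Linear functionals and configurations *)

Section Small.
Variable R : realFieldType.

(** All requirements on the height [e] of the new vertices take this form, which is stable under
    finite conjunctions, so that a single [e] meets them all. *)
Definition small (P : R -> Prop) :=
  exists2 e0, 0 < e0 & forall e, 0 < e -> e <= e0 -> P e.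

Lemma small_and P Q : small P -> small Q -> small (fun e => P e /\ Q e).
Proof.
move=> [e1 e1_gt0 Pe1] [e2 e2_gt0 Qe2]; exists (Num.min e1 e2).
  by rewrite lt_min e1_gt0.
by move=> e e_gt0; rewrite le_min => /andP[??]; split; [apply: Pe1|apply: Qe2].
Qed.

Lemma small_all (J : finType) (P : J -> R -> Prop) :
  (forall j, small (P j)) -> small (fun e => forall j, P j e).
Proof.
move=> smallP.
suff [e0 e0_gt0 Pe0] : small (fun e => forall j, j \in enum J -> P j e).
  by exists e0 => // e e_gt0 le_e j; apply: Pe0; rewrite ?mem_enum.
elim: (enum J) => [|j s IHs]; first by exists 1.
have [e0 e0_gt0 Pe0] := small_and (smallP j) IHs.
exists e0 => // e e_gt0 le_e k; have [Pj Ps] := Pe0 e e_gt0 le_e.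
by rewrite inE => /predU1P[->|/Ps].
Qed.

Lemma small_imp (A : Prop) (P : R -> Prop) :
  (A -> small P) -> small (fun e => A -> P e).
Proof.
have [a /(_ a) [e0 e0_gt0 Pe0]|na _] := pselect A; last by exists 1.
by exists e0 => // e e_gt0 le_e _; exact: Pe0.
Qed.

Lemma small_lin_lt0 (p q : R) : p < 0 -> small (fun e => p + e * q < 0).
Proof.
move=> p_lt0; exists (- p / (2 * (1 + `|q|))).
  by rewrite divr_gt0 ?oppr_gt0 // mulr_gt0 // ltr_pwDl.
move=> e e_gt0; rewrite ler_pdivlMr ?mulr_gt0 ?ltr_pwDl // => le_e.
have := ler_wpM2l (ltW e_gt0) (ler_norm q); have := normr_ge0 q.
nra.
Qed.

End Small.

Section Pairing.
Variables (R : realFieldType) (m : nat).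
Implicit Types (x y : 'rV[R]_m) (f g : 'cV[R]_m).

Definition pairing x g : R := (x *m g) 0 0.

Lemma pairingDl x y g : pairing (x + y) g = pairing x g + pairing y g.
Proof. by rewrite /pairing mulmxDl mxE. Qed.

Lemma pairingZl c x g : pairing (c *: x) g = c * pairing x g.
Proof. by rewrite /pairing -scalemxAl mxE. Qed.

Lemma pairingDr x f g : pairing x (f + g) = pairing x f + pairing x g.
Proof. by rewrite /pairing mulmxDr mxE. Qed.

Lemma pairingZr c x g : pairing x (c *: g) = c * pairing x g.
Proof. by rewrite /pairing -scalemxAr mxE. Qed.

Lemma pairing_suml (J : finType) (P : pred J) (F : J -> 'rV[R]_m) g :
  pairing (\sum_(j | P j) F j) g = \sum_(j | P j) pairing (F j) g.
Proof. by rewrite /pairing mulmx_suml summxE. Qed.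

Lemma pairing_sumr (J : finType) (P : pred J) x (F : J -> 'cV[R]_m) :
  pairing x (\sum_(j | P j) F j) = \sum_(j | P j) pairing x (F j).
Proof. by rewrite /pairing mulmx_sumr summxE. Qed.

Lemma pairing0l g : pairing 0 g = 0.
Proof. by rewrite /pairing mul0mx mxE. Qed.

Lemma pairing_delta x k : pairing x (delta_mx k 0) = x 0 k.
Proof.
rewrite /pairing mxE (bigD1 k) //= big1 ?addr0 ?mxE ?eqxx ?mulr1 // => j /negPf jk.
by rewrite mxE jk mulr0.
Qed.

Lemma pairing_eq0 g : (forall x, pairing x g = 0) -> g = 0.
Proof.
move=> g0; apply/matrixP=> i j; rewrite ord1 mxE -(g0 (delta_mx 0 i)).
by rewrite /pairing -rowE mxE.
Qed.

Section Configuration.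
Variables (I : finType) (X : I -> 'rV[R]_m).

Definition tight g : {set I} := [set i | pairing (X i) g == 0].

Definition valid g := forall i, pairing (X i) g <= 0.

Definition lin_indep (S : {set I}) :=
  forall c : I -> R, \sum_(i in S) c i *: X i = 0 -> forall i, i \in S -> c i = 0.

End Configuration.
End Pairing.

(** The [A j] and [u] form a basis, and [L] consists of the first [D] columns of its inverse matrix.
    The last dual vector is [g] itself, as [g] kills every [A j] and is 1 on [u]. *)
Lemma dual_basis (R : realFieldType) (D : nat) (A : 'I_D -> 'rV[R]_(D + 1))
    (g : 'cV[R]_(D + 1)) :
  (forall c, \sum_j c j *: A j = 0 -> forall j, c j = 0) ->
  g != 0 -> (forall j, pairing (A j) g = 0) ->
  exists (u : 'rV[R]_(D + 1)) (L : 'I_D -> 'cV[R]_(D + 1)),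
    [/\ pairing u g = 1, forall j, pairing u (L j) = 0,
        forall i j, pairing (A i) (L j) = (i == j)%:R
      & forall x, x = \sum_j pairing x (L j) *: A j + pairing x g *: u].
Proof.
move=> indA g0 Ag.
have [u ug] : exists u, pairing u g = 1.
  have [x xg] : exists x, pairing x g != 0.
    apply: contrapT => nx; case/eqP: g0; apply: pairing_eq0 => x.
    by apply/eqP/negPn/negP=> xg; apply: nx; exists x.
  by exists ((pairing x g)^-1 *: x); rewrite pairingZl mulVf.
pose B : 'M[R]_(D + 1) := col_mx (\matrix_j A j) u.
have mulB v : v *m B = \sum_j v 0 (lshift 1 j) *: A j + v 0 (rshift D 0) *: u.
  rewrite -[in LHS](hsubmxK v) mul_row_col mulmx_sum_row; congr (_ + _).
    by apply: eq_bigr => j _; rewrite rowK mxE.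
  by rewrite mulmx_sum_row big_ord1 mxE; congr (_ *: _); apply/rowP=> j; rewrite mxE.
have Bu : B \in unitmx.
  rewrite -row_free_unit; apply: inj_row_free => v; rewrite mulB => vB.
  have v1 : v 0 (rshift D 0) = 0.
    have := congr1 (fun x => pairing x g) vB; rewrite pairingDl pairing_suml pairingZl ug.
    rewrite big1 ?pairing0l ?add0r ?mulr1 // => j _.
    by rewrite pairingZl Ag mulr0.
  have v0 : forall j, v 0 (lshift 1 j) = 0.
    by apply: indA; rewrite v1 scale0r addr0 in vB.
  apply/rowP=> k; rewrite mxE; case: (split_ordP k) => j ->; first exact: v0.
  by rewrite ord1.
pose L j := col (lshift 1 j) (invmx B).
have prL x j : pairing x (L j) = (x *m invmx B) 0 (lshift 1 j).
  by rewrite /pairing /L colE mulmxA -colE mxE.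
have AE i : A i = delta_mx 0 (lshift 1 i) *m B.
  by rewrite -rowE rowKu rowK.
have uE : u = delta_mx 0 (rshift D 0) *m B.
  by rewrite -rowE rowKd; apply/rowP=> j; rewrite mxE.
have xE x : x = \sum_j pairing x (L j) *: A j + pairing x g *: u.
  have e : x = \sum_j pairing x (L j) *: A j + (x *m invmx B) 0 (rshift D 0) *: u.
    rewrite -{1}[x](mulmxKV Bu) mulB; congr (_ + _).
    by apply: eq_bigr => j _; rewrite prL.
  rewrite {1}e; congr (_ + _ *: _); rewrite [in RHS]e pairingDl pairing_suml pairingZl ug.
  by rewrite big1 ?add0r ?mulr1 // => j _; rewrite pairingZl Ag mulr0.
exists u, L; split => //.
- by move=> j; rewrite prL uE mulmxK // mxE eqxx /= eq_lrshift.
- by move=> i j; rewrite prL AE mulmxK // mxE eqxx /= eq_sym (inj_eq (@lshift_inj _ _)).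
Qed.

Lemma big_option (V : Type) (idx : V) (op : Monoid.com_law idx) (J : finType)
    (P : pred (option J)) (F : option J -> V) :
  \big[op/idx]_(o | P o) F o =
  op (if P None then F None else idx) (\big[op/idx]_(j | P (Some j)) F (Some j)).
Proof.
rewrite big_mkcond (bigD1 None) //=; congr (op _ _).
rewrite (reindex_omap Some id) /=; last by case.
by rewrite [RHS]big_mkcond; apply: eq_bigl => j; rewrite eqxx.
Qed.

Lemma sum_minus_delta (R : pzRingType) (J : finType) (c : R) (i : J) (F : J -> R) :
  \sum_j (c - (i == j)%:R) * F j = c * \sum_j F j - F i.
Proof.
under eq_bigr do rewrite mulrBl.
rewrite sumrB -mulr_sumr; congr (_ - _).
rewrite (bigD1 i) //= eqxx mul1r big1 ?addr0 // => j.
by rewrite eq_sym => /negPf->; rewrite mul0r.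
Qed.

Lemma exists_notin (J : finType) (S : {set J}) : (#|S| < #|J|)%N -> exists y, y \notin S.
Proof.
rewrite -(cardsC S) -{1}[#|S|]addn0 ltn_add2l card_gt0 => /set0Pn[y].
by rewrite inE => yS; exists y.
Qed.

Section LinIndep.
Variables (R : realFieldType) (m : nat) (I J : finType).
Variables (X : I -> 'rV[R]_m) (h : J -> I).
Hypothesis h_inj : injective h.

Lemma lin_indep_imset (S : {set J}) :
  lin_indep X (h @: S) <-> lin_indep (X \o h) S.
Proof.
split=> indS c cX.
  pose c' i := if [pick j | h j == i] is Some j then c j else 0.
  have c'h j : c' (h j) = c j.
    rewrite /c'; case: pickP => [j' /eqP/h_inj->//|/(_ j)].
    by rewrite eqxx.
  move=> j jS; rewrite -c'h; apply: indS; last exact: imset_f.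
  rewrite big_imset /=; last by move=> ? ? _ _; exact: h_inj.
  by rewrite -[RHS]cX; apply: eq_bigr => k _; rewrite c'h.
move=> _ /imsetP[j jS ->]; apply: (indS (c \o h)) => //.
rewrite -[RHS]cX big_imset //=; by move=> ? ? _ _; exact: h_inj.
Qed.

End LinIndep.

(** * Combinatorics of the gluing *)

Section Gluing.
Variables (I : finType) (D : nat) (a : 'I_D -> I).

(* [inr None] stands for the apex [w_0] and [inr (Some j)] for [w_j]. *)
Definition old_facet (S : {set I}) : {set I + option 'I_D} :=
  [set z | if z is inl i then i \in S else false].

(** A facet of the cross-polytope on the pairs [a j], [w_j]; [S] holds the indices where the old
    vertex is taken. *)
Definition side_facet (S : {set 'I_D}) : {set I + option 'I_D} :=
  [set z | match z with
           | inl i => i \in a @: S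
           | inr (Some j) => j \notin S
           | inr None => false
           end].

Definition cap_facet (k : 'I_D) : {set I + option 'I_D} :=
  [set z | match z with
           | inl _ => false
           | inr (Some j) => j != k
           | inr None => true
           end].

(** In the middle family [S = setT] would be the old facet, no longer a face, and [S = set0] the
    facet of all [w_j], which the caps replace. *)
Definition glue (Phi : {set {set I}}) : {set {set I + option 'I_D}} :=
  [set old_facet S | S in Phi :\ (a @: setT)]
  :|: [set side_facet S | S in [set S | (S != set0) && (S != setT)]]
  :|: [set cap_facet k | k in 'I_D].

Variant glue_spec (Phi : {set {set I}}) : {set I + option 'I_D} -> Prop :=
| GlueOld S of S \in Phi & S != a @: setT : glue_spec Phi (old_facet S)
| GlueSide S of S != set0 & S != setT : glue_spec Phi (side_facet S)
| GlueCap k : glue_spec Phi (cap_facet k).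

Lemma glueP Phi Z : Z \in glue Phi <-> glue_spec Phi Z.
Proof.
split.
  rewrite !inE => /orP[/orP[]|] /imsetP[S].
  - by rewrite !inE => /andP[? ?] ->; constructor.
  - by rewrite !inE => /andP[? ?] ->; constructor.
  - by move=> _ ->; constructor.
case=> [S SP SF|S S0 S1|k]; rewrite !inE.
- by rewrite imset_f // !inE SF.
- by apply/orP; left; apply/orP; right; apply: imset_f; rewrite inE S0.
- by apply/orP; right; apply: imset_f.
Qed.

Lemma old_facetE S : old_facet S = inl @: S.
Proof.
apply/setP=> -[i|o]; rewrite inE.
  by rewrite mem_imset //; exact: inl_inj.
by apply/esym/negbTE/negP => /imsetP[].
Qed.

Lemma card_glue_set (Z : {set I + option 'I_D}) :
  #|Z| = (#|[set i | inl i \in Z]|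
          + ((inr None \in Z) + #|[set j | inr (Some j) \in Z]|))%N.
Proof.
have b2n (b : bool) : (if b then 1 else 0)%N = b by case: b.
rewrite -!sum1_card big_sumType /=; congr (_ + _)%N.
  by apply: eq_bigl => i; rewrite inE.
rewrite big_option /=
  (eq_bigl (fun j => j \in [set k | inr (Some k) \in Z])).
  by rewrite b2n.
by move=> j; rewrite inE.
Qed.

End Gluing.

(* In [realizes_complete] a bound on the cardinality is enough, without asking for
   [D] independent tight vertices, because all faces turn out to be simplices. *)
Record realizes (R : realFieldType) (D : nat) (I : finType)
    (X : I -> 'rV[R]_(D + 1)) (Phi : {set {set I}}) : Prop := Realizes {
  realizes_pos : forall i, 0 < X i 0 (rshift D 0);
  realizes_cover : forall i, exists2 S, S \in Phi & i \in S;
  realizes_facet : forall S, S \in Phi ->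
    [/\ #|S| = D, lin_indep X S & exists2 g, valid X g & tight X g = S];
  realizes_complete : forall g, g != 0 -> valid X g -> (D <= #|tight X g|)%N ->
    tight X g \in Phi }.

(** * Geometry of the gluing *)

Section GluedPoints.
Variables (R : realFieldType) (D : nat) (I : finType).
Variables (X : I -> 'rV[R]_(D + 1)) (Phi : {set {set I}}) (a : 'I_D -> I).
Hypothesis D_ge2 : (2 <= D)%N.
Hypothesis realX : realizes X Phi.
Hypothesis a_inj : injective a.
Hypothesis card_I : (D < #|I|)%N.
Let F := a @: setT.

(* [L], [g] is the basis dual to the facet vertices completed by [u]; the facet
   is cut out by [g], and [u] points out of the polytope. *)
Variables (g : 'cV[R]_(D + 1)) (u : 'rV[R]_(D + 1)) (L : 'I_D -> 'cV[R]_(D + 1)).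
Hypothesis g_valid : valid X g.
Hypothesis g_tight : tight X g = F.
Hypothesis ug : pairing u g = 1.
Hypothesis uL : forall j, pairing u (L j) = 0.
Hypothesis AL : forall i j, pairing (X (a i)) (L j) = (i == j)%:R.
Hypothesis basisE :
  forall x, x = \sum_j pairing x (L j) *: X (a j) + pairing x g *: u.

(* The lower bound makes [w_0] violate the facet [w_1, ..., w_D], the upper bound
   makes it satisfy the side facets. *)
Variable s : R.
Hypothesis s_lb : 1 < s * D%:R.
Hypothesis s_ub : s * D.-1%:R < 1.

(* Chosen so that [w_i + a_i] is the same point for all [i]. *)
Definition glue_coef (o : option 'I_D) (j : 'I_D) : R :=
  if o is Some i then 2 - (i == j)%:R else 2 - s.

Variable e : R.
Hypothesis e_gt0 : 0 < e.

Definition glue_point (z : I + option 'I_D) : 'rV[R]_(D + 1) :=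
  match z with
  | inl i => X i
  | inr o => \sum_j glue_coef o j *: X (a j) + e *: u
  end.
Let Y := glue_point.

(** What is asked of [e]: new vertices have positive last coordinate and lie strictly inside every
    old facet but [F]; old vertices off [F] lie strictly inside the side and cap facets; [e_through]
    concerns segments from such a vertex to a new one. *)
Hypothesis e_pos : forall o,
  0 < \sum_j glue_coef o j * X (a j) 0 (rshift D 0) + e * u 0 (rshift D 0).
Hypothesis e_old : forall S, S \in Phi -> S != F ->
  exists h, [/\ valid X h, tight X h = S &
    forall o, \sum_j glue_coef o j * pairing (X (a j)) h + e * pairing u h < 0].
Hypothesis e_side : forall (S : {set 'I_D}) y, S != setT -> y \notin F ->
  (2 * #|~: S|%:R - 1) * pairing (X y) g
    + e * (- \sum_(j in ~: S) pairing (X y) (L j)) < 0.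
Hypothesis e_cap : forall k y, y \notin F ->
  (2 - s) * pairing (X y) g
    + e * (- (s * \sum_j pairing (X y) (L j) + (1 - s * D%:R) * pairing (X y) (L k))) < 0.
Hypothesis e_through : forall o y j, y \notin F ->
  glue_coef o j * pairing (X y) g + e * (- pairing (X y) (L j)) < 0.

Lemma s_bounds : 0 < s < 1.
Proof.
have D1 : 1 <= D.-1%:R :> R by rewrite ler1n -ltnS prednK // ltnW.
have : D%:R = D.-1%:R + 1 :> R by rewrite -[1]/(1%:R) -natrD addn1 prednK // ltnW.
move: s_lb s_ub D1; move: (D%:R) (D.-1%:R) => x y + + + xE.
by rewrite {}xE => sx sy y1; apply/andP; split; nra.
Qed.

Lemma Ag j : pairing (X (a j)) g = 0.
Proof.
have : a j \in tight X g by rewrite g_tight imset_f.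
by rewrite inE => /eqP.
Qed.

Lemma yg_lt0 y : y \notin F -> pairing (X y) g < 0.
Proof.
by rewrite -g_tight inE lt_neqAle => ->; exact: g_valid.
Qed.

Lemma pairing_new o f : pairing (Y (inr o)) f =
  \sum_j glue_coef o j * pairing (X (a j)) f + e * pairing u f.
Proof.
rewrite /Y /= pairingDl pairing_suml pairingZl; congr (_ + _).
by apply: eq_bigr => j _; rewrite pairingZl.
Qed.

Lemma pairing_w i f : pairing (Y (inr (Some i))) f =
  2 * (\sum_j pairing (X (a j)) f) - pairing (X (a i)) f + e * pairing u f.
Proof. by rewrite pairing_new /= sum_minus_delta. Qed.

Lemma pairing_w0 f : pairing (Y (inr None)) f =
  (2 - s) * (\sum_j pairing (X (a j)) f) + e * pairing u f.
Proof. by rewrite pairing_new /= mulr_sumr. Qed.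

Lemma sum_AL k : \sum_j pairing (X (a j)) (L k) = 1.
Proof.
rewrite (bigD1 k) //= AL eqxx big1 ?addr0 // => j /negPf jk.
by rewrite AL jk.
Qed.

Lemma sum_Ag : \sum_j pairing (X (a j)) g = 0.
Proof. by rewrite big1 // => j _; rewrite Ag. Qed.

Lemma relation_pairing (c : I + option 'I_D -> R) (Z : {set I + option 'I_D}) f :
  \sum_(z in Z) c z *: Y z = 0 ->
  \sum_(i | inl i \in Z) c (inl i) * pairing (X i) f
    + ((if inr None \in Z then c (inr None) * pairing (Y (inr None)) f else 0)
      + \sum_(j | inr (Some j) \in Z) c (inr (Some j)) * pairing (Y (inr (Some j))) f)
  = 0.
Proof.
move=> /(congr1 (fun x => pairing x f)); rewrite pairing0l pairing_suml => cY.
rewrite -[RHS]cY {cY}.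
rewrite [RHS]big_sumType [X in _ = _ + X]big_option.
congr (_ + (_ + _)); first by apply: eq_bigr => i _; rewrite pairingZl.
  by case: ifP => _ //; rewrite pairingZl.
by apply: eq_bigr => i _; rewrite pairingZl.
Qed.

Lemma sum_delta (S : {set 'I_D}) (c : 'I_D -> R) (k : 'I_D) :
  \sum_(j in S) c j * (j == k)%:R = if k \in S then c k else 0.
Proof.
rewrite big_mkcond (bigD1 k) //= eqxx mulr1 big1 ?addr0 // => j /negPf->.
by rewrite mulr0 if_same.
Qed.

(** All [w_j] pair to [e] with [g], so [g] shows that their coefficients sum to 0. As [w_j] pairs
    with [L k] to 2 minus a Kronecker delta, [L k] then isolates the coefficient of [a k] or of
    [w_k]. *)
Lemma side_indep (S : {set 'I_D}) : lin_indep Y (side_facet a S).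
Proof.
move=> c cY.
have rel f : \sum_(j in S) c (inl (a j)) * pairing (X (a j)) f
    + \sum_(j in ~: S) c (inr (Some j)) * pairing (Y (inr (Some j))) f = 0.
  have := relation_pairing f cY; rewrite inE /= add0r.
  under eq_bigl do rewrite inE; rewrite big_imset /=; last by move=> ? ? _ _; exact: a_inj.
  by under [X in _ + X]eq_bigl do rewrite inE -in_setC.
have d0 : \sum_(j in ~: S) c (inr (Some j)) = 0.
  have := rel g; rewrite big1 => [|j _]; last by rewrite Ag mulr0.
  under eq_bigr do rewrite pairing_w sum_Ag Ag ug mulr0 subr0 mulr1 add0r.
  by rewrite add0r -mulr_suml => /eqP; rewrite mulf_eq0 [e == 0]gt_eqF // orbF => /eqP.
have relL k : (if k \in S then c (inl (a k)) else 0)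
    - (if k \in ~: S then c (inr (Some k)) else 0) = 0.
  rewrite -[RHS](rel (L k)) -(sum_delta S (c \o inl \o a)).
  rewrite -(sum_delta _ (c \o inr \o Some)).
  congr (_ + _).
    by apply: eq_bigr => j _; rewrite AL.
  under [RHS]eq_bigr do rewrite pairing_w sum_AL AL uL mulr0 addr0 mulr1 mulrBr.
  by rewrite sumrB -mulr_suml d0 mul0r sub0r.
case=> [i|[j|]]; rewrite inE //.
  by case/imsetP=> j jS ->; have := relL j; rewrite inE jS subr0.
move=> jS; have := relL j; rewrite inE (negPf jS) /= sub0r => /eqP.
by rewrite oppr_eq0 => /eqP.
Qed.

(** Again [g] makes the coefficients sum to 0, and [L j] then relates the coefficient of [w_j] to
    [s] times that of [w_0]. Since [w_k] does not occur, [j = k] kills the coefficient of [w_0], and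
    then all others vanish. *)
Lemma cap_indep (k : 'I_D) : lin_indep Y (cap_facet I k).
Proof.
move=> c cY.
have rel f : c (inr None) * pairing (Y (inr None)) f
    + \sum_(j in [set~ k]) c (inr (Some j)) * pairing (Y (inr (Some j))) f = 0.
  have := relation_pairing f cY; rewrite inE big_pred0 ?add0r => [|i]; last by rewrite inE.
  by under eq_bigl => j do [rewrite inE; rewrite -in_setC1].
have d0 : c (inr None) + \sum_(j in [set~ k]) c (inr (Some j)) = 0.
  have := rel g; rewrite pairing_w0 sum_Ag ug mulr0 add0r mulr1.
  under eq_bigr do rewrite pairing_w sum_Ag Ag ug mulr0 subr0 mulr1 add0r.
  by rewrite -mulr_suml -mulrDl => /eqP; rewrite mulf_eq0 [e == 0]gt_eqF // orbF => /eqP.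
have relL j : - s * c (inr None) - (if j \in [set~ k] then c (inr (Some j)) else 0) = 0.
  rewrite -[RHS](rel (L j)) -(sum_delta _ (c \o inr \o Some)) pairing_w0 sum_AL uL.
  under [X in _ = _ + X]eq_bigr do rewrite pairing_w sum_AL AL uL mulr0 addr0 mulr1 mulrBr.
  by rewrite sumrB -mulr_suml; nra.
have c0 : c (inr None) = 0.
  have := relL k; rewrite in_setC1 eqxx subr0 => /eqP.
  by rewrite mulf_eq0 oppr_eq0 gt_eqF ?(andP s_bounds).1 //= => /eqP.
case=> [i|[j|]]; rewrite inE // => jk.
by have := relL j; rewrite in_setC1 jk c0 mulr0 sub0r => /eqP; rewrite oppr_eq0 => /eqP.
Qed.

Lemma face_of_sign (Z : {set I + option 'I_D}) f :
  (forall z, z \in Z -> pairing (Y z) f = 0) ->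
  (forall z, z \notin Z -> pairing (Y z) f < 0) ->
  exists2 f', valid Y f' & tight Y f' = Z.
Proof.
move=> Z0 Zlt; exists f.
  by move=> z; have [/Z0->//|/Zlt/ltW] := boolP (z \in Z).
apply/setP=> z; rewrite inE; have [/Z0->|/Zlt/lt_eqF->//] := boolP (z \in Z).
exact: eqxx.
Qed.

Lemma old_vertexP i : (exists j, i = a j) \/ i \notin F.
Proof.
by have [/imsetP[j _ ->]|] := boolP (i \in F); [left; exists j|right].
Qed.

Lemma old_face S : S \in Phi -> S != F ->
  exists2 f, valid Y f & tight Y f = old_facet D S.
Proof.
move=> SPhi SF; have [h [h_valid h_tight h_new]] := e_old SPhi SF.
apply: (@face_of_sign _ h) => -[i|o]; rewrite inE //.
- by rewrite -h_tight inE => /eqP.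
- by rewrite -h_tight inE lt_neqAle h_valid andbT.
- by move=> _; rewrite pairing_new.
Qed.

Lemma card_setC_le (S : {set 'I_D}) : S != set0 -> #|~: S|%:R <= D.-1%:R :> R.
Proof.
by rewrite -card_gt0 ler_nat => S_gt0; have := cardsC S; rewrite card_ord; lia.
Qed.

Lemma side_face (S : {set 'I_D}) : S != set0 -> S != setT ->
  exists2 f, valid Y f & tight Y f = side_facet a S.
Proof.
move=> S0 S1; set n : R := #|~: S|%:R.
(* The sum of the [L j] is 0 at [a i] for [i] in [S], and [2 * n - 1] at [w_i] for [i] outside [S],
   where [g] is [e]; the multiple of [g] makes [f] vanish there too. *)
pose f := (- e) *: (\sum_(j in ~: S) L j) + (2 * n - 1) *: g.
have fE x : pairing x f =
    - e * \sum_(j in ~: S) pairing x (L j) + (2 * n - 1) * pairing x g.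
  by rewrite pairingDr !pairingZr pairing_sumr.
have sumA i : \sum_(j in ~: S) pairing (X (a i)) (L j) = (i \notin S)%:R.
  rewrite (eq_bigr (fun j => 1 * (j == i)%:R)); last first.
    by move=> j _; rewrite AL mul1r eq_sym.
  by rewrite sum_delta inE; case: (i \in S).
have fA i : pairing (Y (inl (a i))) f = - e * (i \notin S)%:R.
  by rewrite fE sumA Ag mulr0 addr0.
have fw i : pairing (Y (inr (Some i))) f = - e * (i \in S)%:R.
  rewrite fE pairing_w sum_Ag Ag ug.
  under eq_bigr do rewrite pairing_w sum_AL uL mulr0 addr0 mulr1.
  rewrite sumrB sumA sumr_const -[2 *+ #|~: S|]mulr_natr -/n.
  by case: (i \in S) => /=; lra.
have fw0 : pairing (Y (inr None)) f < 0.
  rewrite fE pairing_w0 sum_Ag ug.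
  under eq_bigr do rewrite pairing_w0 sum_AL uL mulr0 addr0 mulr1.
  rewrite sumr_const -[(2 - s) *+ #|~: S|]mulr_natr -/n.
  have sn : s * n < 1.
    apply: le_lt_trans s_ub; apply: ler_wpM2l; last exact: card_setC_le.
    by case/andP: s_bounds => /ltW.
  rewrite [ltLHS](_ : _ = e * (s * n - 1)); last by ring.
  by rewrite pmulr_rlt0 // subr_lt0.
have fy y : y \notin F -> pairing (Y (inl y)) f < 0.
  by move=> /(e_side S1); rewrite fE /= -/n; lra.
apply: (@face_of_sign _ f) => -[i|[i|]]; rewrite inE //.
- by case/imsetP=> j jS ->; rewrite fA jS mulr0.
- by rewrite fw => /negPf->; rewrite mulr0.
- case: (old_vertexP i) => [[j ->]|/fy//].
  by rewrite mem_imset // fA => ->; rewrite mulr1 oppr_lt0.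
- by rewrite fw negbK => ->; rewrite mulr1 oppr_lt0.
Qed.

Lemma cap_face (k : 'I_D) : exists2 f, valid Y f & tight Y f = cap_facet I k.
Proof.
(* The bracket gives weight [s] to [L j] for [j != k] and [1 - s * (D - 1)] to [L k]. The weights
   add up to 1, so it is 2 minus the weight of [L i] at [w_i], and [2 - s] at [w_0]. The bounds on
   [s] put the weight of [L k] strictly between 0 and [s], which gives the signs at [a k] and
   [w_k]. *)
pose f := (- e) *: (s *: (\sum_j L j) + (1 - s * D%:R) *: L k) + (2 - s) *: g.
have fE x : pairing x f =
    - e * (s * (\sum_j pairing x (L j)) + (1 - s * D%:R) * pairing x (L k))
      + (2 - s) * pairing x g.
  by rewrite pairingDr !pairingZr pairingDr !pairingZr pairing_sumr.
have sumA i : \sum_j pairing (X (a i)) (L j) = 1.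
  by rewrite (bigD1 i) //= AL eqxx big1 ?addr0 // => j; rewrite AL eq_sym => /negPf->.
have DE : D%:R = D.-1%:R + 1 :> R by rewrite -[1]/(1%:R) -natrD addn1 prednK // ltnW.
have [s_gt0 s_lt1] := andP s_bounds.
have fA i : pairing (Y (inl (a i))) f < 0.
  rewrite fE sumA Ag AL mulr0 addr0 mulNr oppr_lt0 pmulr_rgt0 //.
  move: s_ub; rewrite DE; case: (i == k) => /=; move: (D.-1%:R) => m; nra.
have fw i : pairing (Y (inr (Some i))) f = - e * (s * D%:R - 1) * (i == k)%:R.
  rewrite fE !pairing_w sum_Ag Ag ug sum_AL uL AL.
  under eq_bigr do rewrite pairing_w sum_AL uL mulr0 addr0 mulr1.
  rewrite sumrB sumA sumr_const card_ord -[2 *+ D]mulr_natr.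
  by case: (i == k) => /=; move: (D%:R) => m; ring.
have fw0 : pairing (Y (inr None)) f = 0.
  rewrite fE !pairing_w0 sum_Ag ug sum_AL uL.
  under eq_bigr do rewrite pairing_w0 sum_AL uL mulr0 addr0 mulr1.
  rewrite sumr_const card_ord -[(2 - s) *+ D]mulr_natr; move: (D%:R) => m; ring.
have fy y : y \notin F -> pairing (Y (inl y)) f < 0.
  by move=> /(e_cap k); rewrite fE /=; lra.
apply: (@face_of_sign _ f) => -[i|[i|]]; rewrite inE //.
- by rewrite fw => /negPf->; rewrite mulr0.
- by case: (old_vertexP i) => [[j ->]|/fy].
- rewrite negbK fw => ->; rewrite mulr1 mulNr oppr_lt0 mulr_gt0 // subr_gt0.
  exact: s_lb.
Qed.

Lemma functional_eq0 f :
  (forall j, pairing (X (a j)) f = 0) -> pairing u f = 0 -> f = 0.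
Proof.
move=> Af uf; apply: pairing_eq0 => x.
rewrite [x]basisE pairingDl pairing_suml pairingZl uf mulr0 addr0 big1 // => j _.
by rewrite pairingZl Af mulr0.
Qed.

(* The segment from [y] to a new vertex crosses the cone over [F] in its
   relative interior, so a functional tight at both ends vanishes on [F]. *)
Lemma tight_new_old f o y : f != 0 -> valid Y f ->
  inr o \in tight Y f -> y \notin F -> inl y \notin tight Y f.
Proof.
move=> f0 f_valid; rewrite !inE => /eqP of0 yF; apply/eqP => yf0.
have Af_le0 j : pairing (X (a j)) f <= 0 := f_valid (inl (a j)).
(* Eliminating [u] between the two tightness equations leaves a relation with these coefficients, up
   to sign the coordinates of the crossing point. All are negative, so every term is nonnegative and
   must vanish. *)
pose t j := glue_coef o j * pairing (X y) g + e * (- pairing (X y) (L j)).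
have : \sum_j t j * pairing (X (a j)) f = 0.
  have yE : pairing (X y) f =
      \sum_j pairing (X y) (L j) * pairing (X (a j)) f + pairing (X y) g * pairing u f.
    rewrite {1}[X y]basisE pairingDl pairing_suml pairingZl; congr (_ + _).
    by apply: eq_bigr => j _; rewrite pairingZl.
  have := congr1 ( *%R (pairing (X y) g)) of0; rewrite pairing_new mulr0 mulrDr.
  have := congr1 ( *%R e) yf0; rewrite [pairing (Y _) f]yE mulr0 mulrDr.
  rewrite !mulr_sumr => e1 e2.
  under eq_bigr do rewrite mulrDl.
  rewrite big_split /=.
  have -> : \sum_i glue_coef o i * pairing (X y) g * pairing (X (a i)) f =
     \sum_i pairing (X y) g * (glue_coef o i * pairing (X (a i)) f).
    by apply: eq_bigr => i _; ring.
  have -> : \sum_i e * - pairing (X y) (L i) * pairing (X (a i)) f =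
     - \sum_i e * (pairing (X y) (L i) * pairing (X (a i)) f).
    by rewrite -sumrN; apply: eq_bigr => i _; ring.
  by move: e1 e2; lra.
move/eqP; rewrite psumr_eq0 => [/allP t0|j _]; last first.
  by rewrite mulr_le0 // ltW // e_through.
have Af j : pairing (X (a j)) f = 0.
  have := t0 j (mem_index_enum _); rewrite mulf_eq0 => /orP[|/eqP//].
  by rewrite lt_eqF // e_through.
case/eqP: f0; apply: functional_eq0 => //.
move/eqP: of0; rewrite pairing_new big1 ?add0r => [|j _]; last by rewrite Af mulr0.
by rewrite mulf_eq0 gt_eqF // => /eqP.
Qed.

(** The tight set is an old facet. If it were [F], then [f] would be a multiple of [g], which has
    opposite signs at [w_0] and at an old vertex off [F]. *)
Lemma complete_old f : f != 0 -> valid Y f -> (D <= #|tight Y f|)%N ->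
  (forall o, inr o \notin tight Y f) -> tight Y f \in glue a Phi.
Proof.
move=> f0 f_valid f_card no_new.
have fE : tight Y f = old_facet D (tight X f).
  apply/setP=> -[i|o]; first by rewrite !inE.
  by rewrite (negPf (no_new o)) inE.
rewrite fE; apply/glueP; constructor.
  apply: (realizes_complete realX) => //; first by move=> i; exact: (f_valid (inl i)).
  by move: f_card; rewrite fE old_facetE card_imset //; exact: inl_inj.
apply/eqP => fF.
have Af j : pairing (X (a j)) f = 0.
  have : a j \in tight X f by rewrite fF imset_f.
  by rewrite inE => /eqP.
have [y yF] : exists y, y \notin F.
  by apply: exists_notin; rewrite card_imset // cardsT card_ord.
have := no_new None; rewrite inE pairing_w0 big1 ?mulr0 ?add0r => [|//] uf0.
have := f_valid (inr None); rewrite pairing_w0 big1 ?mulr0 ?add0r => [uf_le0|//].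
have := f_valid (inl y); rewrite /Y /= [X y]basisE pairingDl pairing_suml.
rewrite big1 ?add0r => [|j _].
  have uf_lt0 : e * pairing u f < 0 by rewrite lt_neqAle uf0.
  rewrite pairingZl leNgt nmulr_rgt0 ?yg_lt0 //.
  by rewrite -(pmulr_rlt0 _ e_gt0) uf_lt0.
by rewrite pairingZl Af mulr0.
Qed.

(* [a j] and its opposite [inr (Some j)] span a segment through one interior
   point common to all [j], on which the functional takes the value [P < 0]. *)
Lemma complete_new f o : f != 0 -> valid Y f -> (D <= #|tight Y f|)%N ->
  inr o \in tight Y f -> tight Y f \in glue a Phi.
Proof.
move=> f0 f_valid f_card o_tight; set T := tight Y f.
have [s_gt0 s_lt1] := andP s_bounds.
pose al j := pairing (X (a j)) f.
pose P := 2 * (\sum_j al j) + e * pairing u f.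
have al_le0 j : al j <= 0 := f_valid (inl (a j)).
have wE i : pairing (Y (inr (Some i))) f = P - al i.
  by rewrite pairing_w /P -/(al i); ring.
have w0E : pairing (Y (inr None)) f = P - s * \sum_j al j.
  by rewrite pairing_w0 /P; ring.
have al_ge j : P <= al j by rewrite -subr_le0 -wE f_valid.
have w0_le0 : P <= s * \sum_j al j by rewrite -subr_le0 -w0E f_valid.
pose i0 : 'I_D := Ordinal (ltnW D_ge2).
have P_lt0 : P < 0.
  rewrite lt_neqAle (le_trans (al_ge i0)) // andbT; apply: contra f0 => /eqP P0.
  have al0 j : al j = 0 by apply/eqP; rewrite eq_le al_le0 -P0 al_ge.
  apply/eqP/functional_eq0 => //; apply/eqP; move/eqP: P0.
  by rewrite /P big1 // mulr0 add0r mulf_eq0 gt_eqF.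
pose S0 := [set j | inl (a j) \in T]; pose S1 := [set j | inr (Some j) \in T].
have S0E j : (j \in S0) = (al j == 0) by rewrite !inE.
have S1E j : (j \in S1) = (al j == P) by rewrite !inE wE subr_eq0 eq_sym.
have old_mem i : (inl i \in T) = (i \in a @: S0).
  have [[j ->]|iF] := old_vertexP i; first by rewrite mem_imset // inE.
  rewrite (negPf (tight_new_old f0 f_valid o_tight iF)).
  by apply/esym/negbTE; apply: contra iF => /imsetP[j _ ->]; exact: imset_f.
have TE : #|T| = (#|S0| + ((inr None \in T) + #|S1|))%N.
  rewrite card_glue_set (_ : [set i | _] = a @: S0) ?card_imset //.
  by apply/setP=> i; rewrite inE old_mem.
have S01 : S0 \subset ~: S1.
  apply/subsetP=> j; rewrite in_setC S0E S1E => /eqP->.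
  by rewrite eq_sym lt_eqF.
have cardS1 := cardsC S1; rewrite card_ord in cardS1.
have sum_const : S1 = setT -> \sum_j al j = D%:R * P.
  move=> S1T; rewrite (eq_bigr (fun=> P)) ?sumr_const ?card_ord ?mulr_natl // => j _.
  by apply/eqP; rewrite -S1E S1T inE.
(* [S0] and [S1] are disjoint, so without [w_0] the [D] tight vertices force them to be
   complementary, which is a side facet. [S1 = setT] is excluded because [s * D > 1] would make
   [w_0] violate [f]. *)
have [w0T|w0T] := boolP (inr None \in T); last first.
  have S0C : S0 = ~: S1.
    apply/eqP; rewrite eqEcard S01 /=.
    rewrite -(leq_add2l #|S1|) cardS1 (leq_trans f_card) // -/T TE (negPf w0T).
    by rewrite add0n addnC.
  have -> : T = side_facet a S0.
    apply/setP=> -[i|[j|]]; rewrite [RHS]inE ?old_mem ?(negPf w0T) //.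
    by rewrite S0C !inE negbK.
  apply/glueP; constructor; last first.
    case: o o_tight => [j jT|]; last by rewrite -/T (negPf w0T).
    apply/eqP => S0T; have : j \in S0 by rewrite S0T inE.
    have jS1 : j \in S1 by rewrite in_set.
    by rewrite S0C in_setC jS1.
  apply/eqP => S00; have S1T : S1 = setT by rewrite -[S1]setCK -S0C S00 setC0.
  have := w0_le0; rewrite (sum_const S1T); move: s_lb; move: (D%:R) => m sm; nra.
have sumE : s * \sum_j al j = P.
  by move: (w0T); rewrite inE w0E subr_eq0 eq_sym => /eqP.
(* A zero [al i] would make the sum at least [(D - 1) * P], and [s] times it would exceed [P]
   because [s * (D - 1) < 1]. *)
have S00 : S0 = set0.
  apply/setP=> i; rewrite in_set0 S0E; apply/negbTE/eqP => ali.
  have : P * D.-1%:R <= \sum_j al j.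
    rewrite (bigD1 i) //= ali add0r.
    rewrite (_ : D.-1 = #|[set~ i]|); last by rewrite cardsC1 card_ord.
    rewrite mulr_natr -sumr_const.
    rewrite [leRHS](eq_bigl (mem [set~ i])) ?ler_sum // => j.
    by rewrite /= !inE.
  have := sumE; move: s_ub; move: (D.-1%:R) => m sm; nra.
(* [S1] has at least [D - 1] elements by the count of tight vertices, and is not everything because
   [s * D * P < P]. *)
have [k S1k] : exists k, S1 = [set~ k].
  have S1T : S1 != setT.
    apply/eqP => /sum_const sE; move: sumE; rewrite sE.
    by move: s_lb; move: (D%:R) => m sm; nra.
  have : #|~: S1| == 1%N.
    have : ~: S1 != set0 by rewrite -setCT (inj_eq (@setC_inj _)).
    rewrite -card_gt0 eqn_leq => ->; rewrite andbT -(leq_add2l #|S1|) cardS1.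
    by rewrite (leq_trans f_card) // -/T TE S00 cards0 w0T add0n addnC.
  by case/cards1P=> k kE; exists k; rewrite -kE setCK.
have -> : T = cap_facet I k.
  apply/setP=> -[i|[j|]]; rewrite [RHS]in_set.
  - by rewrite old_mem S00 imset0 in_set0.
  - by rewrite -in_setC1 -S1k [RHS]in_set.
  - by rewrite w0T.
by apply/glueP; constructor.
Qed.

Lemma glue_realizes : realizes Y (glue a Phi).
Proof.
have i0 : 'I_D := Ordinal (ltnW D_ge2).
split.
- case=> [i|o]; first exact: (realizes_pos realX).
  rewrite -pairing_delta pairing_new pairing_delta.
  by under eq_bigr do rewrite pairing_delta.
- case=> [i|[j|]].
  + have [[j ->]|iF] := old_vertexP i.
      exists (side_facet a [set j]); last by rewrite inE mem_imset // inE.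
      apply/glueP; constructor; first by rewrite -card_gt0 cards1.
      apply/eqP=> /(congr1 (fun S => #|pred_of_set S|)).
      by rewrite cards1 cardsT card_ord; lia.
    have [S SP iS] := realizes_cover realX i.
    exists (old_facet D S); last by rewrite inE.
    by apply/glueP; constructor => //; apply: contraNneq iF => SF; rewrite /F -SF.
  + exists (side_facet a [set~ j]); last by rewrite !inE eqxx.
    have := cardsC1 j; rewrite card_ord => cj.
    apply/glueP; constructor; first by rewrite -card_gt0 cj; lia.
    by apply/eqP=> jT; have := in_setT j; rewrite -jT !inE eqxx.
  + by exists (cap_facet I i0); [apply/glueP; constructor|rewrite inE].
- move=> Z /glueP[S SP SF|S S0 S1|k].
  + have [cardS indS _] := realizes_facet realX SP.
    split; last exact: old_face.
      by rewrite old_facetE card_imset //; exact: inl_inj.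
    by rewrite old_facetE; apply/lin_indep_imset => //; exact: inl_inj.
  + split; [|exact: side_indep|exact: side_face].
    rewrite card_glue_set !inE add0n.
    rewrite (_ : [set i | _] = a @: S); last by apply/setP=> i; rewrite !inE.
    rewrite card_imset // (_ : [set j | _] = ~: S); last by apply/setP=> j; rewrite !inE.
    by rewrite cardsC card_ord.
  + split; [|exact: cap_indep|exact: cap_face].
    rewrite card_glue_set !inE.
    rewrite (_ : [set i | _] = set0); last by apply/setP=> i; rewrite !inE.
    rewrite cards0 (_ : [set j | _] = [set~ k]); last by apply/setP=> j; rewrite !inE.
    by rewrite cardsC1 card_ord; lia.
- move=> f f0 f_valid f_card.
  have [/existsP[o of0]|/existsPn no_new] := boolP [exists o, inr o \in tight Y f].
    exact: complete_new of0.
  exact: complete_old.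
Qed.

End GluedPoints.

Lemma glue_exists (R : realFieldType) (D : nat) (I : finType)
    (X : I -> 'rV[R]_(D + 1)) (Phi : {set {set I}}) (a : 'I_D -> I) :
  (2 <= D)%N -> realizes X Phi -> injective a -> a @: setT \in Phi -> (D < #|I|)%N ->
  exists Y : I + option 'I_D -> 'rV[R]_(D + 1), realizes Y (glue a Phi).
Proof.
move=> D_ge2 realX a_inj FPhi card_I.
have [_ indF [g g_valid g_tight]] := realizes_facet realX FPhi.
have Ag j : pairing (X (a j)) g = 0.
  have : a j \in tight X g by rewrite g_tight imset_f.
  by rewrite inE => /eqP.
have g_lt0 y : y \notin a @: setT -> pairing (X y) g < 0.
  by rewrite -g_tight inE lt_neqAle => ->; exact: g_valid.
have g0 : g != 0.
  have [|y /g_lt0] := @exists_notin _ (a @: setT).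
    by rewrite card_imset // cardsT card_ord.
  by apply: contraTneq => ->; rewrite /pairing mulmx0 mxE ltxx.
have indA c : \sum_j c j *: X (a j) = 0 -> forall j, c j = 0.
  move=> cX j; apply: (proj1 (lin_indep_imset X a_inj setT) indF) => //.
  by rewrite -[RHS]cX; apply: eq_bigl => k; rewrite inE.
have [u [L [ug uL AL basisE]]] := dual_basis indA g0 Ag.
(* The inverse of [D - 1/2], hence strictly between [1/D] and [1/(D - 1)]. *)
pose s : R := 2 / (2 * D%:R - 1).
have DE : D%:R = D.-1%:R + 1 :> R by rewrite -[1]/(1%:R) -natrD addn1 prednK // ltnW.
have D1 : 1 <= D.-1%:R :> R by rewrite ler1n -ltnS prednK // ltnW.
have den_gt0 : 0 < 2 * D%:R - 1 :> R by rewrite DE; move: D1; lra.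
have s_lb : 1 < s * D%:R by rewrite /s mulrAC ltr_pdivlMr //; lra.
have s_ub : s * D.-1%:R < 1.
  by rewrite /s mulrAC ltr_pdivrMr // DE; lra.
have [s_gt0 s_lt1] := andP (s_bounds D_ge2 s_lb s_ub).
have coef_gt0 o j : 0 < glue_coef s o j.
  by case: o => [i|] /=; [case: (i == j) => /=|]; lra.
have i0 : 'I_D := Ordinal (ltnW D_ge2).
have coef_sum_lt0 o (x : 'I_D -> R) : (forall j, x j <= 0) -> (exists j, x j < 0) ->
    \sum_j glue_coef s o j * x j < 0.
  move=> x_le0 [j xj]; rewrite (bigD1 j) //= ltr_wnDr // ?sumr_le0 //.
    by move=> k _; rewrite pmulr_rle0.
  by rewrite pmulr_rlt0.
(* Each condition below consists of strict inequalities affine in [e] that hold at [e = 0], hence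
   persist for small [e]. *)
have sm_pos : small (fun e => forall o,
    0 < \sum_j glue_coef s o j * X (a j) 0 (rshift D 0) + e * u 0 (rshift D 0)).
  apply: small_all => o.
  have p_lt0 : - (\sum_j glue_coef s o j * X (a j) 0 (rshift D 0)) < 0.
    rewrite oppr_lt0 (bigD1 i0) //= ltr_wpDr //.
      by apply: sumr_ge0 => j _; rewrite mulr_ge0 // ltW // (realizes_pos realX).
    by rewrite mulr_gt0 // (realizes_pos realX).
  have [e0 e0_gt0 Pe0] := small_lin_lt0 (- u 0 (rshift D 0)) p_lt0.
  by exists e0 => // e e_gt0 /(Pe0 e e_gt0); lra.
have sm_old : small (fun e => forall S, S \in Phi -> S != a @: setT ->
    exists h, [/\ valid X h, tight X h = S &
      forall o, \sum_j glue_coef s o j * pairing (X (a j)) h + e * pairing u h < 0]).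
  apply: small_all => S; apply: small_imp => SPhi; apply: small_imp => SF.
  have [cardS _ [h h_valid h_tight]] := realizes_facet realX SPhi.
  have [e0 e0_gt0 Pe0] : small (fun e => forall o,
      \sum_j glue_coef s o j * pairing (X (a j)) h + e * pairing u h < 0).
    apply: small_all => o; apply/small_lin_lt0/coef_sum_lt0 => [j|].
      exact: h_valid.
    (* Both facets have [D] vertices, so [S] misses some [a j], where [h] is strictly negative. *)
    have [j ajS] : exists j, a j \notin S.
      apply/existsP; rewrite -negb_forall; apply: contra SF => /forallP aS.
      rewrite eq_sym eqEcard card_imset // cardsT card_ord cardS leqnn andbT.
      by apply/subsetP => _ /imsetP[j _ ->].
    by exists j; rewrite lt_neqAle h_valid andbT; move: ajS; rewrite -h_tight inE.
  by exists e0 => // e e_gt0 le_e; exists h; split => //; exact: Pe0.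
have sm_side : small (fun e => forall (S : {set 'I_D}) y, S != setT -> y \notin a @: setT ->
    (2 * #|~: S|%:R - 1) * pairing (X y) g
      + e * (- \sum_(j in ~: S) pairing (X y) (L j)) < 0).
  apply: small_all => S; apply: small_all => y.
  apply: small_imp => ST; apply: small_imp => yF; apply: small_lin_lt0.
  rewrite pmulr_rlt0 ?g_lt0 // subr_gt0.
  have : 1 <= #|~: S|%:R :> R.
    by rewrite ler1n card_gt0 -setCT (inj_eq (@setC_inj _)).
  by lra.
have sm_cap : small (fun e => forall k y, y \notin a @: setT ->
    (2 - s) * pairing (X y) g
      + e * (- (s * \sum_j pairing (X y) (L j) + (1 - s * D%:R) * pairing (X y) (L k))) < 0).
  apply: small_all => k; apply: small_all => y; apply: small_imp => yF.
  by apply: small_lin_lt0; rewrite pmulr_rlt0 ?g_lt0 //; lra.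
have sm_through : small (fun e => forall o y j, y \notin a @: setT ->
    glue_coef s o j * pairing (X y) g + e * (- pairing (X y) (L j)) < 0).
  apply: small_all => o; apply: small_all => y; apply: small_all => j.
  by apply: small_imp => yF; apply: small_lin_lt0; rewrite pmulr_rlt0 ?g_lt0.
have [e0 e0_gt0 Pe0] := small_and sm_pos (small_and sm_old
  (small_and sm_side (small_and sm_cap sm_through))).
have [e_pos [e_old [e_side [e_cap e_through]]]] := Pe0 e0 e0_gt0 (lexx _).
by exists (glue_point X a u s e0); apply: (@glue_realizes _ _ _ _ _ _ _ _ _ _ g u L).
Qed.

(** * Transversals of the glued complex *)

Definition hitting (I : finType) (Phi : {set {set I}}) (T : {set I}) :=
  forall S, S \in Phi -> T :&: S != set0.

Record extremal (I : finType) (D : nat) (Phi : {set {set I}}) (a : 'I_D -> I)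
    (k : nat) : Prop := Extremal {
  extremal_inj : injective a;
  extremal_facet : a @: setT \in Phi;
  extremal_card : #|I| = (k * D.+1)%N;
  extremal_lb : forall T, hitting Phi T -> (2 * k <= #|T|)%N;
  extremal_ub : exists2 T, hitting Phi T & #|T| = (2 * k)%N;
  extremal_full : forall T, hitting Phi T -> a @: setT \subset T ->
    (2 * k < #|T|)%N }.

Section GlueExtremal.
Variables (I : finType) (D : nat) (Phi : {set {set I}}) (a : 'I_D -> I) (k : nat).
Hypothesis D_ge3 : (3 <= D)%N.
Hypothesis ext : extremal Phi a k.
Let F := a @: setT.
Let i0 : 'I_D := Ordinal (ltnW (ltnW D_ge3)).

Definition next_facet (j : 'I_D) : I + option 'I_D :=
  inr (if j == i0 then None else Some j).

Lemma next_facetE : next_facet @: setT = cap_facet I i0.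
Proof.
apply/setP=> -[i|[j|]]; rewrite [RHS]inE.
- by apply/negbTE/negP => /imsetP[j _].
- have [->|ji0] := eqVneq j i0.
    by apply/negbTE/negP => /imsetP[j' _]; rewrite /next_facet; case: eqP => // ne [/esym].
  by apply/imsetP; exists j; rewrite // /next_facet (negPf ji0).
- by apply/imsetP; exists i0; rewrite // /next_facet eqxx.
Qed.

Lemma next_facet_inj : injective next_facet.
Proof.
move=> i j; rewrite /next_facet.
by case: eqP => [->|_]; case: eqP => [->|_] // [].
Qed.

Section Transversal.
Variable T : {set I + option 'I_D}.
Hypothesis T_trans : hitting (glue a Phi) T.
Let T0 := [set i | inl i \in T].
Let T1 := [set j | inr (Some j) \in T].

Lemma old_or_new (S : {set 'I_D}) : S != set0 -> S != setT ->
  (exists2 i, i \in S & a i \in T0) \/ (exists2 j, j \notin S & j \in T1).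
Proof.
move=> S0 S1; have : side_facet a S \in glue a Phi by apply/glueP; constructor.
move=> /T_trans/set0Pn[[i|[j|]]]; rewrite !inE ?andbF //.
  by case/andP=> iT /imsetP[j jS iE]; left; exists j; rewrite // inE -iE.
by case/andP=> jT jS; right; exists j; rewrite ?inE.
Qed.

Lemma cap_hit j : inr None \in T \/ exists2 i, i != j & i \in T1.
Proof.
have : cap_facet I j \in glue a Phi by apply/glueP; constructor.
move=> /T_trans/set0Pn[[i|[i|]]]; rewrite !inE ?andbF // ?andbT; last by left.
by case/andP=> iT ij; right; exists i; rewrite ?inE.
Qed.

(** [F] is the only old facet lost in the gluing, so the old part of a transversal needs repair only
    there; below, [S] is empty or one vertex of [F]. *)
Lemma old_hitting (S : {set I}) : [exists j, a j \in T0 :|: S] ->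
  hitting Phi (T0 :|: S).
Proof.
move=> /existsP[j jT] S' S'Phi; have [->|S'F] := eqVneq S' F.
  by apply/set0Pn; exists (a j); rewrite inE jT imset_f.
have : old_facet D S' \in glue a Phi by apply/glueP; constructor.
move=> /T_trans/set0Pn[[i|o]]; rewrite !inE ?andbF // => /andP[iT iS'].
by apply/set0Pn; exists i; rewrite !inE iT iS'.
Qed.

Lemma proper_sub1 i : [set i] != (setT : {set 'I_D}).
Proof.
apply/eqP=> /(congr1 (fun S => #|pred_of_set S|)).
by rewrite cards1 cardsT card_ord; lia.
Qed.

(** The side facet whose only new vertex is [w_j] can be met only at [w_j]; one vertex of [F] added
    to [T0] makes it hit [Phi]. *)
Lemma missed_new : [forall j, a j \notin T0] ->
  [/\ (2 * k <= #|T0|.+1)%N & T1 = setT].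
Proof.
move=> /forallP miss; split.
  have tr : hitting Phi (T0 :|: [set a i0]).
    by apply: old_hitting; apply/existsP; exists i0; rewrite !inE eqxx orbT.
  apply: leq_trans (extremal_lb ext tr) _.
  by rewrite setUC cardsU1 (leq_trans (leq_add (leq_b1 _) (leqnn _))).
apply/setP=> j; rewrite [RHS]inE; have [||[i _]|[i]] := @old_or_new [set~ j].
- by rewrite -card_gt0 cardsC1 card_ord; lia.
- by apply/eqP=> jT; have := in_setT j; rewrite -jT !inE eqxx.
- by rewrite (negPf (miss i)).
- by rewrite in_setC1 negbK => /eqP->.
Qed.

Lemma hit_old : ~~ [forall j, a j \notin T0] -> (2 * k <= #|T0|)%N.
Proof.
rewrite negb_forall => /existsP[j]; rewrite negbK => jT.
rewrite -[T0]setU0; apply/(extremal_lb ext)/old_hitting.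
by apply/existsP; exists j; rewrite setU0.
Qed.

Lemma cardT : #|T| = (#|T0| + ((inr None \in T) + #|T1|))%N.
Proof. exact: card_glue_set. Qed.

Lemma new_ge1 : (1 <= (inr None \in T) + #|T1|)%N.
Proof.
have [->//|[i _ iT]] := cap_hit i0.
by rewrite (leq_trans _ (leq_addl _ _)) // card_gt0; apply/set0Pn; exists i.
Qed.

Lemma glue_lb : (2 * k.+1 <= #|T|)%N.
Proof.
rewrite cardT; have [miss|hit] := boolP [forall j, a j \notin T0].
  (* At least [2 * k - 1] old vertices and [D >= 3] new ones. *)
  by have [? ->] := missed_new miss; rewrite cardsT card_ord; lia.
have T0_ge := hit_old hit.
have [full|] := boolP (F \subset T0).
  have tr : hitting Phi T0.
    rewrite -[T0]setU0; apply: old_hitting; apply/existsP; exists i0.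
    by rewrite setU0 (subsetP full) // imset_f.
  have := extremal_full ext tr full; have := new_ge1; lia.
case/subsetPn => _ /imsetP[i _ ->] aiT.
(* The side facet with the missing [a i] as only old vertex must be met at some [w_j], and the cap
   facet omitting [w_j] needs a second new vertex. *)
have [||[j]|[j _ jT]] := @old_or_new [set i].
- by rewrite -card_gt0 cards1.
- exact: proper_sub1.
- by rewrite inE => /eqP->; rewrite (negPf aiT).
have T1_ge1 : (0 < #|T1|)%N by rewrite card_gt0; apply/set0Pn; exists j.
have [w0T|[j' j'j j'T]] := cap_hit j; first by rewrite w0T; lia.
suff : (1 < #|T1|)%N by lia.
by apply/card_gt1P; exists j', j.
Qed.

(** Besides [w_0] there are at least [D - 1 >= 2] new vertices, one more than allowed; when [F] is
    missed, having all [D] of the [w_j] makes up for the old vertex that may be lacking. *)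
Lemma glue_full : cap_facet I i0 \subset T -> (2 * k.+1 < #|T|)%N.
Proof.
move=> full; have w0T : inr None \in T by apply: (subsetP full); rewrite inE.
rewrite cardT w0T; have [miss|hit] := boolP [forall j, a j \notin T0].
  by have [? ->] := missed_new miss; rewrite cardsT card_ord; lia.
have T0_ge := hit_old hit.
have : [set~ i0] \subset T1.
  by apply/subsetP=> j; rewrite !inE => ji0; apply: (subsetP full); rewrite inE.
by move=> /subset_leq_card; rewrite cardsC1 card_ord; lia.
Qed.

End Transversal.

(** Take a vertex [a i] in [T] and add [w_i] and [w_0]: every side facet contains [a i] or [w_i],
    and every cap contains [w_0]. *)
Lemma glue_ub : exists2 T, hitting (glue a Phi) T & #|T| = (2 * k.+1)%N.
Proof.
have [T T_trans cardT] := extremal_ub ext.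
have /set0Pn[_ /setIP[/[swap] /imsetP[i _ ->] aiT]] := T_trans _ (extremal_facet ext).
exists [set z : I + option 'I_D | match z with
                | inl i => i \in T | inr None => true | inr (Some j) => j == i end].
  move=> Z /glueP[S SPhi SF|S S0 S1|j]; apply/set0Pn.
  - have /set0Pn[x] := T_trans _ SPhi; rewrite inE => /andP[xT xS].
    by exists (inl x); rewrite !inE xT.
  - have [iS|iS] := boolP (i \in S).
      by exists (inl (a i)); rewrite !inE aiT imset_f.
    by exists (inr (Some i)); rewrite !inE eqxx.
  - by exists (inr None); rewrite !inE.
rewrite card_glue_set inE.
rewrite (_ : [set i | _] = T); last by apply/setP=> x; rewrite !inE.
rewrite (_ : [set j | _] = [set i]); last by apply/setP=> x; rewrite !inE.
by rewrite cards1 cardT; lia.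
Qed.

Lemma glue_extremal : extremal (glue a Phi) next_facet k.+1.
Proof.
split.
- exact: next_facet_inj.
- by rewrite next_facetE; apply/glueP; constructor.
- by rewrite card_sum card_option card_ord (extremal_card ext); lia.
- exact: glue_lb.
- exact: glue_ub.
- by move=> T T_trans; rewrite next_facetE; exact: glue_full.
Qed.

End GlueExtremal.

(** * The initial simplex *)

Section Simplex.
Variables (R : realFieldType) (d : nat).
Let D := d.+1.

(** The rows are the homogenised unit vectors followed by the homogenised origin. *)
Definition simplex_mx : 'M[R]_(D + 1) := block_mx 1%:M (const_mx 1) 0 1%:M.

Definition simplex_facets : {set {set 'I_(D + 1)}} := [set [set~ i] | i in 'I_(D + 1)].

Let X i := row i simplex_mx.
Let G i := col i (invmx simplex_mx).

Lemma simplex_mx_unit : simplex_mx \in unitmx.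
Proof. by rewrite unitmxE det_ublock !det1 mulr1 unitr1. Qed.

Lemma simplex_dual i j : pairing (X i) (G j) = (i == j)%:R.
Proof.
rewrite /pairing /X /G rowE colE mulmxA -[_ *m _ *m invmx _]mulmxA.
rewrite mulmxV ?simplex_mx_unit //.
by rewrite mulmx1 -rowE !mxE eqxx andbT.
Qed.

Lemma simplex_indep S : lin_indep X S.
Proof.
move=> c cX i iS; have := congr1 (fun x => pairing x (G i)) cX.
rewrite pairing0l pairing_suml (bigD1 i) //= pairingZl simplex_dual eqxx mulr1.
rewrite big1 ?addr0 // => j /andP[_ /negPf ji].
by rewrite pairingZl simplex_dual ji mulr0.
Qed.

Lemma simplex_realizes : realizes X simplex_facets.
Proof.
split.
- move=> i; rewrite mxE; case: (split_ordP i) => j ->.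
    by rewrite block_mxEur mxE.
  by rewrite block_mxEdr !ord1 mxE eqxx.
- move=> i; have [j ij] : exists j : 'I_(D + 1), j \in [set~ i].
    by apply/set0Pn; rewrite -card_gt0 cardsC1 card_ord addn1.
  by exists [set~ j]; [exact: imset_f|move: ij; rewrite !inE eq_sym].
- move=> _ /imsetP[i _ ->]; split.
  + by rewrite cardsC1 card_ord addn1.
  + exact: simplex_indep.
  exists (- G i).
    by move=> j; rewrite -scaleN1r pairingZr simplex_dual mulN1r oppr_le0.
  apply/setP=> j; rewrite !inE -scaleN1r pairingZr simplex_dual mulN1r oppr_eq0.
  by case: (j == i); rewrite ?eqxx ?oner_eq0.
- move=> g g0 g_valid g_card.
  have cardT := cardsC (tight X g); rewrite card_ord in cardT.
  (* A functional tight at all [D + 1] vertices is 0 since the matrix is invertible, so exactly one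
     vertex is not tight. *)
  have : #|~: tight X g| == 1%N.
    rewrite eqn_leq card_gt0; apply/andP; split.
      by rewrite -(leq_add2l #|tight X g|) cardT leq_add2r.
    rewrite -setCT (inj_eq (@setC_inj _)); apply: contra g0 => /eqP gT.
    rewrite -[g](mulKmx simplex_mx_unit) (_ : simplex_mx *m g = 0) ?mulmx0 //.
    apply/matrixP=> i j; rewrite ord1 [RHS]mxE.
    have : i \in tight X g by rewrite gT.
    by rewrite inE /pairing -row_mul mxE => /eqP.
  case/cards1P=> i iE; rewrite -[tight X g]setCK iE; exact: (imset_f (fun i => [set~ i])).
Qed.

Definition simplex_facet (j : 'I_D) : 'I_(D + 1) := lshift 1 j.

Lemma simplex_extremal : (2 <= d)%N -> extremal simplex_facets simplex_facet 1.
Proof.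
move=> d_ge2.
have facetE : simplex_facet @: setT = [set~ rshift D 0].
  apply/setP=> i; rewrite in_setC1; case: (split_ordP i) => j ->.
    by rewrite eq_lrshift imset_f.
  rewrite ord1 eqxx; apply/negbTE/negP => /imsetP[k _ /eqP].
  by rewrite eq_rlshift.
split.
- exact: lshift_inj.
- by rewrite facetE; exact: (imset_f (fun i => [set~ i])).
- by rewrite card_ord mul1n addn1.
- move=> T T_trans; rewrite muln1.
  have /set0Pn[i /setIP[iT _]] := T_trans [set~ ord0] (imset_f _ isT).
  have /set0Pn[j] := T_trans [set~ i] (imset_f _ isT).
  by rewrite !inE => /andP[jT ji]; apply/card_gt1P; exists j, i.
- exists [set lshift 1 ord0; rshift D 0]; last by rewrite cards2 eq_lrshift.
  move=> _ /imsetP[i _ ->]; apply/set0Pn.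
  have [->|ni] := eqVneq i (rshift D 0).
    by exists (lshift 1 ord0); rewrite !inE eqxx eq_lrshift.
  by exists (rshift D 0); rewrite !inE eqxx orbT eq_sym.
- move=> T _ /subset_leq_card; rewrite facetE cardsC1 card_ord => le_T.
  by rewrite muln1 (leq_trans _ le_T) // addn1.
Qed.

End Simplex.

Lemma extremal_tower (R : realFieldType) (d k : nat) : (2 <= d)%N ->
  exists (I : finType) (X : I -> 'rV[R]_(d.+1 + 1)) Phi a,
    realizes X Phi /\ @extremal I d.+1 Phi a k.+1.
Proof.
move=> d_ge2; elim: k => [|k [I [X [Phi [a [realX ext]]]]]].
  by do 4!eexists; split; [exact: simplex_realizes|exact: simplex_extremal].
have [Y realY] :
    exists Y : I + option 'I_d.+1 -> 'rV[R]_(d.+1 + 1), realizes Y (glue a Phi).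
  apply: (glue_exists _ realX); rewrite ?(extremal_facet ext) ?(extremal_card ext) //.
  - exact: ltnW.
  - exact: extremal_inj ext.
  - by rewrite mulSn; lia.
exists (I + option 'I_d.+1)%type, Y, (glue a Phi), (next_facet I (d_ge2 : (3 <= d.+1)%N)).
by split=> //; exact: glue_extremal.
Qed.

Lemma bigminn_leq (J : finType) (P : pred J) (F : J -> nat) m j :
  P j -> (\big[minn/m]_(i | P i) F i <= F j)%N.
Proof.
move=> Pj; have := mem_index_enum j.
elim: (index_enum J) => // i s IHs; rewrite inE big_cons => /predU1P[<-|/IHs le_s].
  by rewrite Pj geq_minl.
by case: ifP => // _; exact: leq_trans (geq_minr _ _) le_s.
Qed.

(** * Back to polytopes *)

Section Dehomogenize.
Variables (R : realFieldType) (D : nat) (I : finType).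
Variables (X : I -> 'rV[R]_(D + 1)) (Phi : {set {set I}}).
Hypothesis D_gt0 : (0 < D)%N.
Hypothesis realX : realizes X Phi.
Hypothesis card_I : (D < #|I|)%N.
Let n := #|I|.
Let r (i : 'I_n) : I := enum_val i.
Let t i := X (r i) 0 (rshift D 0).

(** Central projection to the hyperplane where the last coordinate is 1; [t i] is positive, so signs
    of functionals are kept. *)
Definition dehomogenize (i : 'I_n) : 'rV[R]_D := (t i)^-1 *: lsubmx (X (r i)).
Let V := dehomogenize.

Lemma t_gt0 i : 0 < t i. Proof. exact: realizes_pos realX _. Qed.

Lemma homogenizeE i : X (r i) = t i *: row_mx (V i) 1%:M.
Proof.
rewrite scale_row_mx scalerA divff ?gt_eqF ?t_gt0 // scale1r -{1}[X (r i)]hsubmxK.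
by congr row_mx; apply/rowP=> j; rewrite !ord1 !mxE eqxx mulr1.
Qed.

Lemma sum_homogenize (c : 'I_n -> R) (P : pred 'I_n) :
  \sum_(i | P i) c i / t i *: X (r i)
  = row_mx (\sum_(i | P i) c i *: V i) (\sum_(i | P i) c i)%:M.
Proof.
rewrite -[LHS]hsubmxK !raddf_sum /=; congr row_mx; apply: eq_bigr => i _;
  rewrite homogenizeE scalerA divfK ?gt_eqF ?t_gt0 // linearZ /=.
  by rewrite row_mxKl.
by rewrite row_mxKr scale_scalar_mx mulr1.
Qed.

Definition face_functional (a : 'rV[R]_D) (b : R) : 'cV[R]_(D + 1) := col_mx a^T (- b)%:M.

Lemma pairing_homogenize a b i :
  pairing (X (r i)) (face_functional a b) = t i * (dotv a (V i) - b).
Proof.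
rewrite homogenizeE pairingZl; congr (_ * _).
rewrite /pairing mul_row_col mul1mx !mxE eqxx mulr1n; congr (_ - _).
by apply: eq_bigr => k _; rewrite [a^T _ _]mxE mulrC.
Qed.

Lemma pull_indep (S : {set 'I_n}) : lin_indep X (r @: S) -> aff_indep V S.
Proof.
move/(lin_indep_imset _ enum_val_inj) => indS c c0 cV i iS.
have : c i / t i = 0.
  apply: (indS (fun i => c i / t i)) => //.
  by rewrite sum_homogenize c0 cV raddf0 row_mx0.
by move/eqP; rewrite mulf_eq0 invr_eq0 [t i == 0]gt_eqF ?t_gt0 // orbF => /eqP.
Qed.

Lemma face_functionalE g : exists a b, g = face_functional a b.
Proof.
exists (usubmx g)^T, (- g (rshift D 0) 0); rewrite /face_functional trmxK opprK.
rewrite -[LHS]vsubmxK; congr col_mx.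
by apply/matrixP=> i j; rewrite !ord1 !mxE eqxx mulr1n.
Qed.

Lemma valid_homogenize a b :
  valid X (face_functional a b) <-> forall i, dotv a (V i) <= b.
Proof.
split=> ab i.
  by have := ab (r i); rewrite pairing_homogenize pmulr_rle0 ?t_gt0 // subr_le0.
by rewrite -(enum_rankK i) pairing_homogenize pmulr_rle0 ?t_gt0 // subr_le0 ab.
Qed.

Lemma tight_homogenize a b :
  tight X (face_functional a b) = r @: [set i | dotv a (V i) == b].
Proof.
apply/setP=> i; rewrite -(enum_rankK i) mem_imset; last exact: enum_val_inj.
by rewrite !inE pairing_homogenize mulf_eq0 subr_eq0 gt_eqF ?t_gt0.
Qed.

Lemma card_pull (S : {set 'I_n}) : #|r @: S| = #|S|.
Proof. by apply: card_imset; exact: enum_val_inj. Qed.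

Lemma push_pull (S : {set I}) : r @: (r @^-1: S) = S.
Proof.
apply/setP=> j; rewrite -(enum_rankK j) mem_imset ?inE //; exact: enum_val_inj.
Qed.

Lemma facet_pull (S : {set 'I_n}) : is_facet V S <-> r @: S \in Phi.
Proof.
split=> [[[a [b [a0 [ab SE]]]] [S' [S'S _ cardS']]]|SPhi].
  have -> : r @: S = tight X (face_functional a b) by rewrite tight_homogenize SE.
  apply: (realizes_complete realX); last 1 first.
  - by rewrite tight_homogenize card_pull -SE -cardS' subset_leq_card.
  - apply: contra a0 => /eqP; rewrite /face_functional -[0]vsubmxK => /eq_col_mx[aT _].
    by rewrite -[a]trmxK aT -trmx_eq0 trmxK; apply/eqP/matrixP=> i j; rewrite !mxE.
  - exact/valid_homogenize.
have [cardS indS [g g_valid g_tight]] := realizes_facet realX SPhi.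
have [a [b gE]] := face_functionalE g; subst g.
have SE : S = [set i | dotv a (V i) == b].
  by apply: (imset_inj (@enum_val_inj _ I)); rewrite -g_tight tight_homogenize.
rewrite card_pull in cardS.
split; last by exists S; split=> //; exact: pull_indep.
exists a, b; split; last by split=> //; exact/valid_homogenize.
(* Were [a] zero, the nonempty [S] would force [b = 0] and make every vertex tight, but [S] has only
   [D] of them. *)
have [|y] := @exists_notin _ S; first by rewrite cardS card_ord.
apply: contraNneq => a0.
have dot0 i : dotv a (V i) = 0.
  by rewrite /dotv big1 // => k _; rewrite a0 mxE mul0r.
have /card_gt0P[i] : (0 < #|S|)%N by rewrite cardS.
by rewrite SE !inE !dot0.
Qed.

Lemma facet_exists (i : 'I_n) :
  exists (S : {set 'I_n}) (a : 'rV[R]_D) (b : R), [/\ i \in S, aff_indep V S, #|S| = D,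
  forall j, dotv a (V j) <= b & S = [set j | dotv a (V j) == b]].
Proof.
have [S0 S0Phi iS0] := realizes_cover realX (r i).
pose S := r @^-1: S0.
have SE : r @: S = S0 := push_pull S0.
have [cardS indS _] := realizes_facet realX S0Phi.
have SPhi : r @: S \in Phi by rewrite SE.
have [[a [b [_ [ab Sab]]]] _] := proj2 (facet_pull S) SPhi.
exists S, a, b; split => //; first by rewrite inE.
  by apply: pull_indep; rewrite SE.
by rewrite -card_pull SE.
Qed.

Lemma simplicial_pull : simplicial V.
Proof.
move=> S /facet_pull/(realizes_facet realX)[_ indS _]; exact: pull_indep.
Qed.

Lemma dotv_sum a (P : pred 'I_n) (c : 'I_n -> R) :
  dotv a (\sum_(i | P i) c i *: V i) = \sum_(i | P i) c i * dotv a (V i).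
Proof.
rewrite /dotv; under eq_bigr do rewrite summxE mulr_sumr.
rewrite exchange_big; apply: eq_bigr => i _ /=; rewrite mulr_sumr.
by apply: eq_bigr => k _; rewrite mxE mulrCA.
Qed.

(** A facet gives [D] independent vertices; its functional isolates the coefficient of one more
    vertex [y] off the facet. *)
Lemma full_dimensional_pull : full_dimensional V.
Proof.
have n_gt0 : (0 < n)%N := leq_ltn_trans (leq0n D) card_I.
have [S [a [b [_ indS cardS ab SE]]]] := facet_exists (Ordinal n_gt0).
have [y yS] : exists y, y \notin S.
  by apply: exists_notin; rewrite cardS card_ord.
exists (y |: S); split; last by rewrite cardsU1 yS cardS.
move=> c; rewrite !big_setU1 //= => c0 cV.
have cy : c y = 0.
  have /(congr1 (dotv a)) := cV; rewrite -(big_setU1 _ yS) dotv_sum big_setU1 //=.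
  rewrite (eq_bigr (fun i => c i * b)); last first.
    by move=> i; rewrite SE inE => /eqP->.
  rewrite -mulr_suml /dotv [RHS]big1; last by move=> k _; rewrite mxE mulr0.
  move=> eq0; have : c y * (dotv a (V y) - b) = 0.
    by move: c0 eq0; rewrite /dotv; set s := \sum_(i in S) c i; nra.
  move/eqP; rewrite mulf_eq0 subr_eq0 => /orP[/eqP//|yb].
  by move: yS; rewrite SE inE yb.
rewrite cy scale0r add0r in cV; rewrite cy add0r in c0.
by move=> i /setU1P[->//|iS]; exact: indS iS.
Qed.

(** The inequality of a facet through [V i] is tight at [V i], so a convex combination equal to
    [V i] has weights only on that facet, against the affine independence of its vertices. *)
Lemma convex_position_pull : convex_position V.
Proof.
move=> i lam lam_ge0 lam1 lamV.
have [S [a [b [iS indS _ ab SE]]]] := facet_exists i.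
have iab : dotv a (V i) = b by move: iS; rewrite SE inE => /eqP.
have lam0 j : j != i -> j \notin S -> lam j = 0.
  have : \sum_(j | j != i) lam j * (b - dotv a (V j)) = 0.
    under eq_bigr do rewrite mulrBr.
    by rewrite sumrB -mulr_suml lam1 mul1r -dotv_sum lamV iab subrr.
  move/eqP; rewrite psumr_eq0 => [/allP h ji|k _]; last first.
    by rewrite mulr_ge0 // subr_ge0.
  have := h j (mem_index_enum _); rewrite ji /= mulf_eq0 => /orP[/eqP//|].
  by rewrite subr_eq0 SE inE eq_sym => ->.
pose c j := if j == i then -1 else lam j.
(* Stated for any module, to serve for the points and, with the constant 1, for the sum of the
   coefficients. *)
have sumc (W : lmodType R) (v : 'I_n -> W) :
    \sum_(j in S) c j *: v j = \sum_(j | j != i) lam j *: v j - v i.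
  rewrite (bigD1 i) //= /c eqxx scaleN1r addrC; congr (_ - _).
  rewrite [RHS](bigID (mem S)) /= [X in _ = _ + X]big1 ?addr0; last first.
    by move=> j /andP[ji jS]; rewrite lam0 ?scale0r.
  rewrite (eq_bigl (fun j => (j != i) && (j \in S))) => [|j]; last by rewrite andbC.
  by apply: eq_bigr => j /andP[/negPf->].
have : c i = 0.
  apply: indS => //; last by rewrite sumc lamV subrr.
  have := sumc R^o (fun=> 1); rewrite -!scaler_suml lam1 scale1r subrr => /eqP.
  by rewrite scaler_eq0 oner_eq0 orbF => /eqP.
by rewrite /c eqxx => /eqP; rewrite oppr_eq0 oner_eq0.
Qed.

Lemma hitting_pull (T : {set 'I_n}) :
  Defs.is_transversal V T <-> hitting Phi (r @: T).
Proof.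
have pullI (S : {set 'I_n}) : (r @: T :&: r @: S == set0) = (T :&: S == set0).
  by rewrite -imsetI ?imset_eq0 // => ? ? _ _; exact: enum_val_inj.
split=> [/forall_inP trT S SPhi|trT].
  rewrite -[S]push_pull pullI; apply: trT; rewrite inE; apply/asboolP/facet_pull.
  by rewrite push_pull.
by apply/forall_inP => S; rewrite inE => /asboolP/facet_pull/trT; rewrite pullI.
Qed.

Lemma tau_pull m : (forall T, hitting Phi T -> (m <= #|T|)%N) ->
  (exists2 T, hitting Phi T & #|T| = m) -> tau V = m.
Proof.
move=> lb [T trT cardT].
have trT' : Defs.is_transversal V (r @^-1: T).
  by apply/hitting_pull; rewrite push_pull.
apply/eqP; rewrite eqn_leq; apply/andP; split.
  rewrite -cardT -[in leqRHS](push_pull T) card_pull.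
  exact: (bigminn_leq (fun S : {set 'I_n} => #|S|)).
rewrite /tau; elim/big_ind: _ => [|x y mx my|S /hitting_pull/lb].
(* The default value of the minimum is the number of vertices, which bounds the size [m] of [T]. *)
- by rewrite -cardT max_card.
- by rewrite leq_min mx.
- by rewrite card_pull.
Qed.

End Dehomogenize.

Theorem theorem1p2 (R : realType) (d N : nat) : (2 <= d)%N ->
  exists (n : nat) (V : 'I_n -> 'rV[R]_(d.+1)),
    [/\ convex_position V, full_dimensional V, simplicial V,
        (N <= n)%N &
        (tau V)%:Q / n%:Q = 2%:Q / (d + 2)%:Q].
Proof.
(* [N] gluings give [(N + 1) * (d + 2)] vertices and transversal number [2 * (N + 1)]. *)
move=> d_ge2; have [I [X [Phi [a [realX ext]]]]] := extremal_tower R N d_ge2.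
have cardI := extremal_card ext.
have card_gt : (d.+1 < #|I|)%N by rewrite cardI mulSn; lia.
exists #|I|, (dehomogenize X); split.
- exact: convex_position_pull realX card_gt.
- exact: full_dimensional_pull realX card_gt.
- exact: simplicial_pull realX card_gt.
- by rewrite cardI mulSn; nia.
- rewrite (tau_pull _ realX card_gt (extremal_lb ext) (extremal_ub ext)) // cardI.
  rewrite intrD -!pmulrn !natrM -[d.+2]addn2 natrD.
  have N0 : N.+1%:R != 0 :> rat by rewrite pnatr_eq0.
  have d0 : d%:R + 2 != 0 :> rat by rewrite -natrD pnatr_eq0 addn2.
  move: N0 d0; move: (N.+1%:R) (d%:R) => x y x0 y0.
  by field; rewrite x0 y0.
Qed.
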